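(* Fix $k\in\{1,2\}$ and consider the optimal power flow problem (P1) with cost $C_k$ and its semidefinite relaxation (P3) with cost $\tilde C_k$, both defined in the context. Let $\mathbf{V}_{\mathrm{opt}}$ denote the optimal solution of (P3), and assume that $\mathrm{rank}(\mathbf{V}_{\mathrm{opt}})=1$. Then the vector of line-to-ground voltages $\mathbf{v}_{\mathrm{opt}}:=\sqrt{\lambda_1}\,\mathbf{u}_1$, where $\lambda_1>0$ is the unique non-zero eigenvalue of $\mathbf{V}_{\mathrm{opt}}$ and $\mathbf{u}_1$ is a corresponding unit-norm eigenvector whose phase is chosen so that the sub-vector of $\mathbf{v}_{\mathrm{opt}}$ at node $0$ equals the reference $\mathbf{v}_0$, is a globally optimal solution of (P1) (that is, $\mathbf{v}_{\mathrm{opt}}$ together with the currents and generated powers it determines through the constraints of (P1) is feasible for (P1) and attains its minimum cost).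
   Context: Network. Nodes $\mathcal{N}=\{0,1,\dots,N\}$ (node $0$ is the point of common coupling, PCC), set of lines $\mathcal{E}\subset\mathcal{N}\times\mathcal{N}$ (undirected lines, each listed once), $\mathcal{N}_n$ the set of nodes joined to $n$ by a line. $\mathcal{P}_n\subseteq\{a,b,c\}$ is the nonempty set of phases at node $n$ (with $\mathcal{P}_0=\{a,b,c\}$), $\mathcal{P}_{mn}\subseteq\mathcal{P}_m\cap\mathcal{P}_n$ the set of phases of line $(m,n)$. Each line has an invertible phase impedance matrix $\mathbf{Z}_{mn}=\mathbf{Z}_{nm}$ and a shunt admittance matrix $\mathbf{Y}^{(s)}_{mn}=\mathbf{Y}^{(s)}_{nm}$, both in $\mathbb{C}^{|\mathcal{P}_{mn}|\times|\mathcal{P}_{mn}|}$. $V_n^\phi, I_n^\phi\in\mathbb{C}$ are the voltage and injected current at node $n$, phase $\phi\in\mathcal{P}_n$; $\mathbf{v}_n,\mathbf{i}_n$ stack them over $\phi\in\mathcal{P}_n$, and $\mathbf{v},\mathbf{i}$ stack $\mathbf{v}_n,\mathbf{i}_n$ over $n\in\mathcal{N}$. The vector $\mathbf{v}_0\in\mathbb{C}^3$ is a given (nonzero) reference. $[\cdot]_{\mathcal{P}}$ and $[\cdot]_{\mathcal{P},\mathcal{P}'}$ denote sub-vectors/sub-matrices indexed by the given sets; $(\cdot)^{\mathcal{T}}$ transpose, $(\cdot)^*$ conjugate, $(\cdot)^{\mathcal{H}}$ conjugate transpose; $j=\sqrt{-1}$. $\mathcal{S}\subset\mathcal{N}\setminus\{0\}$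 is the set of nodes with distributed generation (DG); $P_{L,n}^\phi,Q_{L,n}^\phi$ are given real loads, $y_{C,n}^\phi$ given real capacitor susceptances ($0$ if there is no capacitor), $V_n^{\min},V_n^{\max}$ given nonnegative voltage limits, $P_{G,s}^{\min},P_{G,s}^{\max},Q_{G,s}^{\min},Q_{G,s}^{\max}$ given real limits, and $c_0>0$, $c_s\ge 0$ ($s\in\mathcal{S}$) given costs. The current from $m$ to $n$ on a line is $\mathbf{i}_{m\to n}=\mathbf{Z}_{mn}^{-1}([\mathbf{v}_m]_{\mathcal{P}_{mn}}-[\mathbf{v}_n]_{\mathcal{P}_{mn}})$ and $P_{m\to n}=\Re\{\sum_{\phi\in\mathcal{P}_{mn}}V_m^\phi(I_{m\to n}^\phi)^*\}$. Problem (P1). Minimize, over voltages, currents and DG powers $\{P_{G,s}^\phi,Q_{G,s}^\phi\}$, the cost $C_k$, where $C_1=\sum_{(m,n)\in\mathcal{E}}(P_{m\to n}+P_{n\to m})$ and $C_2=c_0\Re\{\sum_{\phi\in\mathcal{P}_0}V_0^\phi(I_0^\phi)^*\}+\sum_{s\in\mathcal{S}}c_s\sum_{\phi\in\mathcal{P}_s}P_{G,s}^\phi$, subject to: (i) $V_s^\phi(I_s^\phi)^*=P_{G,s}^\phi-P_{L,s}^\phi+j(Q_{G,s}^\phi-Q_{L,s}^\phi)$ for $s\in\mathcal{S},\phi\in\mathcal{P}_s$; (ii) $V_n^\phi(I_n^\phi)^*=-P_{L,n}^\phi-jQ_{L,n}^\phi+jy_{C,n}^\phi|V_n^\phi|^2$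 for $n\in\mathcal{N}\setminus(\mathcal{S}\cup\{0\})$, $\phi\in\mathcal{P}_n$; (iii) $I_n^\phi=\sum_{m\in\mathcal{N}_n:\,\phi\in\mathcal{P}_{mn}}\big[(\tfrac12\mathbf{Y}^{(s)}_{mn}+\mathbf{Z}_{mn}^{-1})[\mathbf{v}_n]_{\mathcal{P}_{mn}}-\mathbf{Z}_{mn}^{-1}[\mathbf{v}_m]_{\mathcal{P}_{mn}}\big]_{\{\phi\}}$ for all $n\in\mathcal{N},\phi\in\mathcal{P}_n$; (iv) $V_n^{\min}\le|V_n^\phi|\le V_n^{\max}$ for all $n\in\mathcal{N},\phi\in\mathcal{P}_n$; (v) $P_{G,s}^{\min}\le P_{G,s}^\phi\le P_{G,s}^{\max}$, $Q_{G,s}^{\min}\le Q_{G,s}^\phi\le Q_{G,s}^{\max}$ for $s\in\mathcal{S},\phi\in\mathcal{P}_s$; (vi) the voltage vector at node $0$ equals the reference $\mathbf{v}_0$. Matrices. $\mathbf{Y}$ is the matrix (taken symmetric) for which (iii) reads $\mathbf{i}=\mathbf{Y}\mathbf{v}$: its $(m,n)$ off-diagonal block for a line is $-\mathbf{Z}_{mn}^{-1}$ on rows/columns $\mathcal{P}_{mn}$ and zero on other phases, and its $n$-th diagonal block is $\sum_{m\in\mathcal{N}_n}(\tfrac12\mathbf{Y}_{mn}^{(s)}+\mathbf{Z}_{mn}^{-1})$ with each summand padded with zeros on phases in $\mathcal{P}_n\setminus\mathcal{P}_{mn}$; all other blocks are zero. Let $\bar{\mathbf{e}}_n^\phi$ be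 the canonical basis vector of $\mathbb{R}^{\sum_n|\mathcal{P}_n|}$ associated with node $n$ and phase $\phi$, $\mathbf{Y}_n^\phi:=\bar{\mathbf{e}}_n^\phi(\bar{\mathbf{e}}_n^\phi)^{\mathcal{T}}\mathbf{Y}$, and $\mathbf{\Phi}_{P,n}^\phi:=\frac12(\mathbf{Y}_n^\phi+(\mathbf{Y}_n^\phi)^{\mathcal{H}})$, $\mathbf{\Phi}_{Q,n}^\phi:=\frac{j}{2}(\mathbf{Y}_n^\phi-(\mathbf{Y}_n^\phi)^{\mathcal{H}})$, $\mathbf{\Phi}_{V,n}^\phi:=\bar{\mathbf{e}}_n^\phi(\bar{\mathbf{e}}_n^\phi)^{\mathcal{T}}$, $\mathbf{\Phi}_{m\to n}:=\frac12(\mathbf{A}_{m\to n}^{\mathcal{H}}\mathbf{B}_m+\mathbf{B}_m^{\mathcal{H}}\mathbf{A}_{m\to n})$, where $\mathbf{A}_{m\to n},\mathbf{B}_m$ are the $|\mathcal{P}_{mn}|\times\sum_n|\mathcal{P}_n|$ matrices with $\mathbf{A}_{m\to n}\mathbf{v}=\mathbf{Z}_{mn}^{-1}([\mathbf{v}_m]_{\mathcal{P}_{mn}}-[\mathbf{v}_n]_{\mathcal{P}_{mn}})$ and $\mathbf{B}_m\mathbf{v}=[\mathbf{v}_m]_{\mathcal{P}_{mn}}$ for all $\mathbf{v}$. Problem (P3). Minimize $\tilde C_k(\mathbf{V})$ over Hermitian matrices $\mathbf{V}$ of size $\sum_n|\mathcal{P}_n|$, where $\tilde C_1(\mathbf{V})=\sum_{(m,n)\in\mathcal{E}}(\mathrm{Tr}(\mathbf{\Phi}_{m\to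 n}\mathbf{V})+\mathrm{Tr}(\mathbf{\Phi}_{n\to m}\mathbf{V}))$ and $\tilde C_2(\mathbf{V})=\sum_{s\in\mathcal{S}\cup\{0\}}c_s\sum_{\phi\in\mathcal{P}_s}\mathrm{Tr}(\mathbf{\Phi}_{P,s}^\phi\mathbf{V})$, subject to: $\mathrm{Tr}(\mathbf{\Phi}_{P,n}^\phi\mathbf{V})+P_{L,n}^\phi=0$ and $\mathrm{Tr}(\mathbf{\Phi}_{Q,n}^\phi\mathbf{V})+Q_{L,n}^\phi-y_{C,n}^\phi\mathrm{Tr}(\mathbf{\Phi}_{V,n}^\phi\mathbf{V})=0$ for $n\in\mathcal{N}\setminus(\mathcal{S}\cup\{0\})$, $\phi\in\mathcal{P}_n$; $P_{G,s}^{\min}\le\mathrm{Tr}(\mathbf{\Phi}_{P,s}^\phi\mathbf{V})+P_{L,s}^\phi\le P_{G,s}^{\max}$ and $Q_{G,s}^{\min}\le\mathrm{Tr}(\mathbf{\Phi}_{Q,s}^\phi\mathbf{V})+Q_{L,s}^\phi\le Q_{G,s}^{\max}$ for $s\in\mathcal{S},\phi\in\mathcal{P}_s$; $(V_n^{\min})^2\le\mathrm{Tr}(\mathbf{\Phi}_{V,n}^\phi\mathbf{V})\le(V_n^{\max})^2$ for all $n\in\mathcal{N},\phi\in\mathcal{P}_n$; $\mathbf{V}\succeq\mathbf{0}$ and $[\mathbf{V}]_{\mathcal{P}_0,\mathcal{P}_0}=\mathbf{v}_0\mathbf{v}_0^{\mathcal{H}}$. *)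

(* Defs.v *)
From HB Require Import structures.
From mathcomp Require Import all_boot all_order all_algebra.
From mathcomp Require Import complex.
From mathcomp Require Import reals.

Set Implicit Arguments.
Unset Strict Implicit.
Unset Printing Implicit Defensive.

Import Order.TTheory GRing.Theory Num.Theory.

Local Open Scope ring_scope.
Local Open Scope sesquilinear_scope.

Notation phase := 'I_3.

(** * Vectors and matrices indexed by sets of phases

    A vector indexed by [A : {set phase}] is a ['cV_#|A|] whose [i]-th entry
    belongs to the phase [enum_val i]. *)

Section PhaseIndexed.
Variable C : comNzRingType.
Implicit Types A B D : {set phase}.

(** The entry of [x] at phase [phi]; it is [0] when [phi \notin A]. *)
Definition phase_entry A (x : 'cV[C]_#|A|) (phi : phase) : C :=
  \sum_(i | enum_val i == phi) x i 0.

(** For [A \subset B], [phase_sel A B *m x] is the sub-vector [x]_A of a vector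
    [x] indexed by [B]. *)
Definition phase_sel A B : 'M[C]_(#|A|, #|B|) :=
  \matrix_(i, j) (enum_val i == enum_val j)%:R.

(** [M] placed on the rows and columns of [A], and zero on other phases. *)
Definition phase_pad A B D (M : 'M[C]_#|A|) : 'M[C]_(#|B|, #|D|) :=
  (phase_sel A B)^T *m M *m phase_sel A D.

Lemma phase_entry_notin A (x : 'cV[C]_#|A|) phi :
  phi \notin A -> phase_entry x phi = 0.
Proof.
move=> nA; rewrite /phase_entry big_pred0 // => i.
by apply: contraNF nA => /eqP<-; apply: enum_valP.
Qed.

Lemma phase_entry_in A (x : 'cV[C]_#|A|) i :
  phase_entry x (enum_val i) = x i 0.
Proof.
by rewrite /phase_entry (big_pred1 i) // => j; rewrite (inj_eq enum_val_inj).
Qed.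

Lemma phase_entry_pad A B (x : 'cV[C]_#|A|) phi :
  phi \in B -> phase_entry ((phase_sel A B)^T *m x) phi = phase_entry x phi.
Proof.
move=> phiB; rewrite -(enum_rankK_in phiB phiB) phase_entry_in !mxE.
rewrite /phase_entry [RHS]big_mkcond; apply: eq_bigr => j _; rewrite !mxE.
by case: ifP => _; rewrite ?mul1r ?mul0r.
Qed.

Lemma phase_entryD A (x y : 'cV[C]_#|A|) phi :
  phase_entry (x + y) phi = phase_entry x phi + phase_entry y phi.
Proof.
by rewrite /phase_entry -big_split; apply: eq_bigr => i _; rewrite mxE.
Qed.

Lemma phase_entryN A (x : 'cV[C]_#|A|) phi :
  phase_entry (- x) phi = - phase_entry x phi.
Proof. by rewrite /phase_entry -sumrN; apply: eq_bigr => i _; rewrite mxE. Qed.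

Lemma phase_entry_sum A I (r : seq I) Q (x : I -> 'cV[C]_#|A|) phi :
  phase_entry (\sum_(k <- r | Q k) x k) phi =
  \sum_(k <- r | Q k) phase_entry (x k) phi.
Proof.
rewrite /phase_entry exchange_big /=; apply: eq_bigr => i _.
by rewrite summxE.
Qed.

End PhaseIndexed.

Arguments phase_sel {C} A B.
Arguments phase_pad {C A} B D M.

Definition psd (R : realType) (d : nat) (V : 'M[R[i]]_d) : Prop :=
  V \is hermsymmx /\ forall x : 'cV[R[i]]_d, 0 <= (x ^t* *m V *m x) 0 0.

(** * The network *)

(** Node [ord0] is the point of common coupling.  An undirected line is listed
    once in [lines], as an ordered pair; its data are attached to that pair, so
    that Z_mn = Z_nm and Y^(s)_mn = Y^(s)_nm hold by construction of the
    accessors below.  Values of the line data outside [lines] are never used. *)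
Record network (R : realType) (N : nat) := Network {
  lines : {set 'I_N.+1 * 'I_N.+1};
  nphases : 'I_N.+1 -> {set phase};
  lphases : 'I_N.+1 * 'I_N.+1 -> {set phase};
  limpedance : forall e, 'M[R[i]]_#|lphases e|;
  lshunt : forall e, 'M[R[i]]_#|lphases e|
}.

Section Network.
Variables (R : realType) (N : nat) (net : network R N).
Local Notation C := R[i].
Local Notation node := 'I_N.+1.
Local Notation P := (nphases net).
Local Notation dim := (\sum_(n < N.+1) #|P n|)%N.
Implicit Types (m n : node) (phi : phase) (v : 'cV[C]_dim).

Definition line m n : node * node :=
  if (m, n) \in lines net then (m, n) else (n, m).

Definition neighbors n : {set node} :=
  [set m | ((m, n) \in lines net) || ((n, m) \in lines net)].

Definition Pl m n : {set phase} := lphases net (line m n).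

Definition Z m n : 'M[C]_#|Pl m n| := limpedance net (line m n).

Definition Ysh m n : 'M[C]_#|Pl m n| := lshunt net (line m n).

(** The entry of a stacked vector at node [n] and phase [phi]. *)
Definition entry v n phi : C := phase_entry (submxcol v n) phi.

Definition subvec v n (A : {set phase}) : 'cV[C]_#|A| :=
  phase_sel A (P n) *m submxcol v n.

Definition line_current v m n : 'cV[C]_#|Pl m n| :=
  invmx (Z m n) *m (subvec v m (Pl m n) - subvec v n (Pl m n)).

Definition line_power v m n : R :=
  complex.Re (\sum_(phi in Pl m n)
    entry v m phi * (phase_entry (line_current v m n) phi)^*).

Definition injected_current v n phi : C :=
  \sum_(m in neighbors n | phi \in Pl m n)
    phase_entry ((2^-1 *: Ysh m n + invmx (Z m n)) *m subvec v n (Pl m n)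
                 - invmx (Z m n) *m subvec v m (Pl m n)) phi.

Definition Ybus : 'M[C]_dim :=
  \mxblock_(m < N.+1, n < N.+1)
    (if m == n then
       \sum_(k in neighbors n)
         phase_pad (P m) (P n) (2^-1 *: Ysh k n + invmx (Z k n))
     else if m \in neighbors n then
       - phase_pad (P m) (P n) (invmx (Z m n))
     else 0).

Definition ebar n phi : 'cV[C]_dim :=
  \mxcol_(m < N.+1) \col_(i < #|P m|) ((m == n) && (enum_val i == phi))%:R.

Definition Ynode n phi : 'M[C]_dim := ebar n phi *m (ebar n phi)^T *m Ybus.

Definition PhiP n phi : 'M[C]_dim :=
  2^-1 *: (Ynode n phi + (Ynode n phi) ^t*).

Definition PhiQ n phi : 'M[C]_dim :=
  ('i%C / 2) *: (Ynode n phi - (Ynode n phi) ^t*).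

Definition PhiV n phi : 'M[C]_dim := ebar n phi *m (ebar n phi)^T.

Definition subvec_mx n (A : {set phase}) : 'M[C]_(#|A|, dim) :=
  \mxrow_(m < N.+1) (if m == n then phase_sel A (P m) else 0).

Definition Bline m n : 'M[C]_(#|Pl m n|, dim) := subvec_mx m (Pl m n).

Definition Aline m n : 'M[C]_(#|Pl m n|, dim) :=
  invmx (Z m n) *m (subvec_mx m (Pl m n) - subvec_mx n (Pl m n)).

Definition Phiflow m n : 'M[C]_dim :=
  2^-1 *: ((Aline m n) ^t* *m Bline m n + (Bline m n) ^t* *m Aline m n).

Record network_axioms : Prop := NetworkAxioms {
  lines_once : forall m n, (m, n) \in lines net -> (n, m) \notin lines net;
  nphases_neq0 : forall n, P n != set0;
  nphases_pcc : P ord0 = [set: phase];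
  lphases_sub : forall m n, (m, n) \in lines net -> Pl m n \subset P m :&: P n;
  impedance_unit : forall m n, (m, n) \in lines net -> Z m n \in unitmx;
  Ybus_sym : Ybus^T = Ybus
}.

Lemma subvec_mxP v n (A : {set phase}) : subvec_mx n A *m v = subvec v n A.
Proof.
rewrite -[v in LHS]submxcolK mul_mxrow_mxcol (bigD1 n) //= eqxx big1 ?addr0 //.
by move=> m /negPf->; rewrite mul0mx.
Qed.

Lemma Bline_mul v m n : Bline m n *m v = subvec v m (Pl m n).
Proof. exact: subvec_mxP. Qed.

Lemma Aline_mul v m n : Aline m n *m v = line_current v m n.
Proof. by rewrite -mulmxA mulmxBl !subvec_mxP. Qed.

Lemma Ybus_mul v n phi : network_axioms -> phi \in P n ->
  entry (Ybus *m v) n phi = injected_current v n phi.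
Proof.
move=> ax phiP; have nloop : n \notin neighbors n.
  rewrite inE orbb; apply/negP => h; have := lines_once ax h; by rewrite h.
have nsym m : (n \in neighbors m) = (m \in neighbors n).
  by rewrite !inE orbC.
have lsym m : m \in neighbors n -> line n m = line m n.
  rewrite inE /line; case: ifP => h1; case: ifP => h2 //=.
  by have := lines_once ax h1; rewrite h2.
rewrite /entry -[v in LHS]submxcolK mul_mxblock_mxrow mxcolK.
rewrite (bigD1 n) //= eqxx phase_entryD mulmx_suml !phase_entry_sum.
rewrite [X in _ + X](bigID (mem (neighbors n))) /=.
rewrite [X in _ + (_ + X)]big1 ?addr0; last first.
  move=> m /andP[nm mn]; rewrite eq_sym (negPf nm) nsym (negPf mn) mul0mx.
  by rewrite /phase_entry big1 // => ? _; rewrite mxE.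
rewrite [X in _ + X](eq_bigl (mem (neighbors n))); last first.
  move=> m /=; case: eqP => [->|] //=; by rewrite (negPf nloop).
rewrite -big_split /= /injected_current big_mkcondr /=.
apply: eq_bigr => m mn.
have nm : (n == m) = false by apply: contraNF nloop => /eqP {1}->.
have mnn : (m == n) = false by rewrite eq_sym.
rewrite nm nsym mn.
have -> : phase_pad (P n) (P m) (invmx (Z n m))
        = phase_pad (P n) (P m) (invmx (Z m n)).
  by rewrite /Z /Pl (lsym _ mn).
rewrite /phase_pad mulNmx phase_entryN -!mulmxA !phase_entry_pad //.
rewrite phase_entryD phase_entryN; case: ifPn => // nphi.
by rewrite !phase_entry_notin ?subr0.
Qed.

End Network.

(** * The optimal power flow problem and its semidefinite relaxation *)

(** Generation limits and the costs of nodes other than [ord0] only matter on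
    [dg], and nodal data only matter on the phases of the node. *)
Record opf_data (R : realType) (N : nat) (net : network R N) := OpfData {
  dg : {set 'I_N.+1};
  pload : 'I_N.+1 -> phase -> R;
  qload : 'I_N.+1 -> phase -> R;
  ycap : 'I_N.+1 -> phase -> R;
  vmin : 'I_N.+1 -> R;
  vmax : 'I_N.+1 -> R;
  pgmin : 'I_N.+1 -> R;
  pgmax : 'I_N.+1 -> R;
  qgmin : 'I_N.+1 -> R;
  qgmax : 'I_N.+1 -> R;
  price : 'I_N.+1 -> R;
  vref : 'cV[R[i]]_#|nphases net ord0|
}.

Record opf_axioms (R : realType) (N : nat) (net : network R N)
    (d : opf_data net) : Prop := OpfAxioms {
  dg_pcc : ord0 \notin dg d;
  vmin_ge0 : forall n, 0 <= vmin d n;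
  vmax_ge0 : forall n, 0 <= vmax d n;
  price_pcc : 0 < price d ord0;
  price_dg : forall s, s \in dg d -> 0 <= price d s;
  vref_neq0 : vref d != 0
}.

(** [Losses] selects the costs with index 1, [SupplyCost] those with index 2. *)
Inductive objective := Losses | SupplyCost.

(** A value of the decision variables; [pgen] and [qgen] only matter at the
    nodes of [dg] and on their phases. *)
Record opf_point (R : realType) (N : nat) (net : network R N) := OpfPoint {
  volt : 'cV[R[i]]_(\sum_(n < N.+1) #|nphases net n|);
  curr : 'cV[R[i]]_(\sum_(n < N.+1) #|nphases net n|);
  pgen : 'I_N.+1 -> phase -> R;
  qgen : 'I_N.+1 -> phase -> R
}.

Section Problems.
Variables (R : realType) (N : nat) (net : network R N) (d : opf_data net).
Local Notation C := R[i].
Local Notation node := 'I_N.+1.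
Local Notation P := (nphases net).
Local Notation dim := (\sum_(n < N.+1) #|P n|)%N.
Implicit Types (k : objective) (x : opf_point net) (V : 'M[C]_dim).

Definition P1_cost k x : R :=
  match k with
  | Losses =>
      \sum_(e in lines net)
        (line_power (volt x) e.1 e.2 + line_power (volt x) e.2 e.1)
  | SupplyCost =>
      price d ord0 *
        complex.Re (\sum_(phi in P ord0)
          entry (volt x) ord0 phi * (entry (curr x) ord0 phi)^*)
      + \sum_(s in dg d) price d s * \sum_(phi in P s) pgen x s phi
  end.

Record P1_feasible x : Prop := P1Feasible {
  P1_dg : forall s phi, s \in dg d -> phi \in P s ->
    entry (volt x) s phi * (entry (curr x) s phi)^* =
    (pgen x s phi - pload d s phi)%:C%C
    + 'i%C * (qgen x s phi - qload d s phi)%:C%C;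
  P1_load : forall n phi, n \notin ord0 |: dg d -> phi \in P n ->
    entry (volt x) n phi * (entry (curr x) n phi)^* =
    - (pload d n phi)%:C%C - 'i%C * (qload d n phi)%:C%C
    + 'i%C * (ycap d n phi)%:C%C * `|entry (volt x) n phi| ^+ 2;
  P1_current : forall n phi, phi \in P n ->
    entry (curr x) n phi = injected_current (volt x) n phi;
  P1_voltage : forall n phi, phi \in P n ->
    (vmin d n)%:C%C <= `|entry (volt x) n phi| <= (vmax d n)%:C%C;
  P1_pgen : forall s phi, s \in dg d -> phi \in P s ->
    pgmin d s <= pgen x s phi <= pgmax d s;
  P1_qgen : forall s phi, s \in dg d -> phi \in P s ->
    qgmin d s <= qgen x s phi <= qgmax d s;
  P1_ref : submxcol (volt x) ord0 = vref d
}.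

Definition P1_optimal k x : Prop :=
  P1_feasible x /\ forall y, P1_feasible y -> P1_cost k x <= P1_cost k y.

(** Currents are determined by the voltages through the network equations, and
    generated powers by the power balance at the nodes of [dg]. *)
Definition point_of_voltage (v : 'cV[C]_dim) : opf_point net :=
  let pow n phi := entry v n phi * (injected_current v n phi)^* in
  {| volt := v;
     curr := \mxcol_(n < N.+1)
               \col_(i < #|P n|) injected_current v n (enum_val i);
     pgen := fun s phi => complex.Re (pow s phi) + pload d s phi;
     qgen := fun s phi => complex.Im (pow s phi) + qload d s phi |}.

(** The traces below are complex numbers (with zero imaginary part when [V] is
    Hermitian); [z <= w] in [R[i]] means that [w - z] is a nonnegative real. *)
Definition P3_cost k V : C :=
  match k with
  | Losses =>
      \sum_(e in lines net)
        (\tr (Phiflow net e.1 e.2 *m V) + \tr (Phiflow net e.2 e.1 *m V))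
  | SupplyCost =>
      \sum_(s in ord0 |: dg d)
        (price d s)%:C%C * \sum_(phi in P s) \tr (PhiP net s phi *m V)
  end.

Record P3_feasible V : Prop := P3Feasible {
  P3_pload : forall n phi, n \notin ord0 |: dg d -> phi \in P n ->
    \tr (PhiP net n phi *m V) + (pload d n phi)%:C%C = 0;
  P3_qload : forall n phi, n \notin ord0 |: dg d -> phi \in P n ->
    \tr (PhiQ net n phi *m V) + (qload d n phi)%:C%C
    - (ycap d n phi)%:C%C * \tr (PhiV net n phi *m V) = 0;
  P3_pgen : forall s phi, s \in dg d -> phi \in P s ->
    (pgmin d s)%:C%C <= \tr (PhiP net s phi *m V) + (pload d s phi)%:C%C
                     <= (pgmax d s)%:C%C;
  P3_qgen : forall s phi, s \in dg d -> phi \in P s ->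
    (qgmin d s)%:C%C <= \tr (PhiQ net s phi *m V) + (qload d s phi)%:C%C
                     <= (qgmax d s)%:C%C;
  P3_voltage : forall n phi, phi \in P n ->
    (vmin d n)%:C%C ^+ 2 <= \tr (PhiV net n phi *m V)
                         <= (vmax d n)%:C%C ^+ 2;
  P3_psd : psd V;
  P3_ref : submxblock V ord0 ord0 = vref d *m (vref d) ^t*
}.

Definition P3_optimal k V : Prop :=
  P3_feasible V /\ forall W, P3_feasible W -> P3_cost k V <= P3_cost k W.

(** [u] is a unit-norm eigenvector of [V] for [lam], with its phase chosen so
    that [sqrt lam *: u] agrees with the reference voltage at node [ord0]. *)
Definition aligned_eigenvector V (lam : R) (u : 'cV[C]_dim) : Prop :=
  [/\ V *m u = lam%:C%C *: u,
      \sum_i `|u i 0| ^+ 2 = 1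
    & submxcol ((Num.sqrt lam)%:C%C *: u) ord0 = vref d].

End Problems.

(* Main.v *)
(** For a rank-one matrix [v v^H] the traces in (P3) are exactly the powers and
    squared voltage magnitudes at [v], so (P1) is (P3) restricted to matrices of
    rank one, up to the constant cost of the loads at the generation nodes.  A
    positive semidefinite matrix of rank one is [w w^H]; its [ord0] block fixes
    [w] at node [ord0] up to a unit scalar, as the reference is nonzero. *)

Require Import Defs.
From HB Require Import structures.
From mathcomp Require Import all_boot all_order all_algebra.
From mathcomp Require Import complex ring.
From mathcomp Require Import reals.

Import Order.TTheory GRing.Theory Num.Theory.
Local Open Scope ring_scope.
Local Open Scope sesquilinear_scope.

(** * Outer products of a column with its adjoint *)

Section Adjoint.
Context {C : numClosedFieldType}.

Lemma adjmx_mul {m n p} (A : 'M[C]_(m, n)) (B : 'M[C]_(n, p)) :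
  (A *m B) ^t* = B ^t* *m A ^t*.
Proof. by rewrite trmx_mul map_mxM. Qed.

Lemma adjmx_scale {m n} (a : C) (A : 'M[C]_(m, n)) :
  (a *: A) ^t* = a^* *: A ^t*.
Proof. by rewrite linearZ /= map_mxZ. Qed.

Lemma scale_outer {n} (a : C) (x : 'cV[C]_n) :
  (a *: x) *m (a *: x) ^t* = `|a| ^+ 2 *: (x *m x ^t*).
Proof. by rewrite adjmx_scale -scalemxAl -scalemxAr scalerA normCK. Qed.

Lemma mxtrace_outer {n} (M : 'M[C]_n) (x : 'cV[C]_n) :
  \tr (M *m (x *m x ^t*)) = (x ^t* *m M *m x) 0 0.
Proof. by rewrite mulmxA mxtrace_mulC mulmxA /mxtrace big_ord1. Qed.

(** Both traces are 1x1 quadratic forms, on which the adjoint is conjugation. A [Phi] built from a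
    matrix and its adjoint thus yields a real or an imaginary part. *)
Lemma mxtrace_adj_outer {n} (M : 'M[C]_n) (x : 'cV[C]_n) :
  \tr (M ^t* *m (x *m x ^t*)) = (\tr (M *m (x *m x ^t*)))^*.
Proof.
rewrite !mxtrace_outer.
have -> : x ^t* *m M ^t* *m x = (x ^t* *m M *m x) ^t*.
  by rewrite !adjmx_mul trmxCK mulmxA.
by rewrite !mxE.
Qed.

Lemma normsq_col {n} (x : 'cV[C]_n) : x ^t* *m x = (\sum_i `|x i 0| ^+ 2)%:M.
Proof.
rewrite [LHS]mx11_scalar mxE; congr _%:M; apply: eq_bigr => i _.
by rewrite !mxE normCKC.
Qed.

Lemma normsq_gt0 {n} (x : 'cV[C]_n) : x != 0 -> 0 < \sum_i `|x i 0| ^+ 2.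
Proof.
move=> x0; rewrite lt_def sumr_ge0 ?andbT => [|i _]; last exact: exprn_ge0.
apply: contraNneq x0 => /psumr_eq0P x0; apply/eqP/matrixP => i j.
rewrite ord1 [RHS]mxE; apply/eqP; rewrite -normr_eq0 -sqrf_eq0 x0 // => k _.
exact: exprn_ge0.
Qed.

(** Eigenvectors here are rows: for such a [y], the scalar [c = y *m x] is nonzero, since otherwise
    [mu *: y = 0]. Multiplying the eigenvalue equation by [x] on the right leaves
    [c * |x|^2 = mu * c]. *)
Lemma outer_norm_eigenvalue {n} (x : 'cV[C]_n) (mu : C) : x != 0 -> mu != 0 ->
  eigenvalue (x *m x ^t*) mu = (mu == \sum_i `|x i 0| ^+ 2).
Proof.
move=> x0 mu0; apply/eigenvalueP/eqP => [[y yV y0]|->].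
  move: yV; rewrite mulmxA [y *m x]mx11_scalar mul_scalar_mx.
  move Ec : ((y *m x) 0 0) => c yV.
  have c0 : c != 0.
    apply: contra_neq y0 => e; move: yV; rewrite e scale0r => /esym/eqP.
    by rewrite scaler_eq0 (negPf mu0) => /eqP.
  apply: (mulIf c0); have := congr1 (fun z => (z *m x) 0 0) yV.
  by rewrite -!scalemxAl normsq_col !mxE eqxx mulr1n -Ec mxE => <-;
     rewrite mulrC.
exists (x ^t*); first by rewrite mulmxA normsq_col mul_scalar_mx.
by apply: contraNneq x0 => e; rewrite -[x]trmxCK e trmx0 map_mx0.
Qed.

Lemma outer_neq0 {n} (x : 'cV[C]_n) : x != 0 -> x *m x ^t* != 0.
Proof.
move=> x0; apply: contraNneq (x0) => e; have := mulmxA x (x ^t*) x.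
rewrite e mul0mx normsq_col mul_mx_scalar => /eqP.
by rewrite scaler_eq0 gt_eqF ?normsq_gt0.
Qed.

(** Multiplying the equality by [x] on the right makes [x] a multiple of [y]; comparing the nonzero
    outer products then forces modulus 1. *)
Lemma outer_inj_phase {n} (x y : 'cV[C]_n) :
  x != 0 -> x *m x ^t* = y *m y ^t* -> exists2 c : C, `|c| = 1 & x = c *: y.
Proof.
move=> x0 xy.
have [c xc] : exists c : C, x = c *: y.
  have := congr1 (mulmx^~ x) xy; rewrite -!mulmxA normsq_col.
  rewrite [y ^t* *m x]mx11_scalar !mul_mx_scalar => e.
  exists ((\sum_i `|x i 0| ^+ 2)^-1 * (y ^t* *m x) 0 0).
  by rewrite -scalerA -e scalerA mulVf ?scale1r ?gt_eqF ?normsq_gt0.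
exists c => //; have := scale_outer c y; rewrite -xc -xy => /eqP.
rewrite -[X in X == _]scale1r -subr_eq0 -scalerBl scaler_eq0.
by rewrite (negPf (outer_neq0 _ x0)) orbF subr_eq0 eq_sym sqrp_eq1 // => /eqP.
Qed.

End Adjoint.

(** * Positive semidefinite matrices of rank one *)

Section PositiveRankOne.
Context {R : realType} {n : nat}.
Local Notation C := R[i].
Implicit Types (V : 'M[C]_n) (x w : 'cV[C]_n).

Lemma psd_outer x : psd (x *m x ^t*).
Proof.
split.
  by apply/is_hermitianmxP; rewrite expr0 scale1r adjmx_mul trmxCK.
move=> y; rewrite mulmxA -mulmxA -[x ^t* *m y]trmxCK adjmx_mul trmxCK.
by rewrite mxE big_ord1 !mxE -normCK exprn_ge0.
Qed.

(** Rank 1 factors [V] as a column times a row; let [w] be the adjoint of the row. Hermitian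
    symmetry makes the column parallel to [w], positivity makes the remaining scalar [s]
    nonnegative, and [sqrtC s] is absorbed into the vector. *)
Lemma psd_rank1_outer V : psd V -> \rank V = 1%N ->
  exists2 w : 'cV[C]_n, w != 0 & V = w *m w ^t*.
Proof.
move=> [/is_hermitianmxP]; rewrite expr0 scale1r => Vh Vpos rV.
have [a [b Vab]] : exists (a : 'cV[C]_n) (b : 'rV[C]_n), V = a *m b.
  have := mulmx_base V; move: (col_base V) (row_base V); rewrite rV => a b <-.
  by exists a, b.
have V0 : V != 0 by rewrite -mxrank_eq0 rV.
have b0 : b != 0 by apply: contraNneq V0 => e; rewrite Vab e mulmx0.
pose w := b ^t*; have w0 : w != 0.
  by apply: contraNneq b0 => e; rewrite -[b]trmxCK -/w e trmx0 map_mx0.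
have wb : w ^t* = b by rewrite trmxCK.
pose t := \sum_i `|w i 0| ^+ 2.
have bw : b *m w = t%:M by rewrite -wb normsq_col.
have t0 : 0 < t by exact: normsq_gt0.
have [s Vs] : exists s : C, V = s *: (w *m w ^t*).
  (* Applied to [w], the factored [V] gives [t *: a], while its adjoint gives a multiple of [w]. *)
  have := congr1 (mulmx^~ w) Vh; rewrite Vab adjmx_mul -!mulmxA bw -/w.
  rewrite [a ^t* *m w]mx11_scalar !mul_mx_scalar => e.
  exists (t^-1 * (a ^t* *m w) 0 0).
  rewrite [in RHS]scalemxAl -scalerA -e scalerA mulVf ?scale1r ?gt_eqF //.
  by rewrite wb.
have s0 : 0 <= s.
  have := Vpos w; rewrite Vs -scalemxAr -scalemxAl mulmxA normsq_col -/t.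
  rewrite mul_scalar_mx -scalemxAl normsq_col -/t scale_scalar_mx.
  by rewrite scale_scalar_mx mxE eqxx mulr1n pmulr_lge0 // mulr_gt0.
exists (sqrtC s *: w).
  apply: contraNneq V0 => e.
  by rewrite Vs scalemxAl -[s]sqrtCK expr2 -scalerA e scaler0 mul0mx.
by rewrite scale_outer ger0_norm ?sqrtC_ge0 // sqrtCK.
Qed.

End PositiveRankOne.

(** * Traces against an outer product as powers and squared voltage magnitudes *)

Section Traces.
Context {R : realType} {N : nat} (net : network R N).
Local Notation C := R[i].
Local Notation P := (nphases net).
Local Notation dim := (\sum_(n < N.+1) #|P n|)%N.
Implicit Types (m n : 'I_N.+1) (phi : phase) (v : 'cV[C]_dim).
Implicit Types (A : {set phase}).

Definition injected_power v n phi : C :=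
  entry v n phi * (injected_current v n phi)^*.

Lemma ebar_mul v n phi : (ebar net n phi)^T *m v = (entry v n phi)%:M.
Proof.
rewrite -[v in LHS]submxcolK tr_mxcol mul_mxrow_mxcol (bigD1 n) //=.
rewrite big1 ?addr0 => [|m mn]; last first.
  apply/matrixP => i j; rewrite !mxE big1 // => l _.
  by rewrite !mxE (negPf mn) mul0r.
rewrite [LHS]mx11_scalar mxE; congr _%:M.
rewrite /entry /phase_entry [RHS]big_mkcond; apply: eq_bigr => i _.
by rewrite !mxE eqxx /=; case: ifP; rewrite ?mul1r ?mul0r.
Qed.

(** Serves [Ynode], with [M] the bus admittance matrix, and [PhiV], with [M] the identity. *)
Lemma mxtrace_ebar (M : 'M[C]_dim) v n phi :
  \tr (ebar net n phi *m (ebar net n phi)^T *m M *m (v *m v ^t*)) =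
  (entry v n phi)^* * entry (M *m v) n phi.
Proof.
have eJ : (ebar net n phi) ^t* = (ebar net n phi)^T.
  by apply/matrixP => i j; rewrite !mxE conjC_nat.
rewrite mxtrace_outer !mulmxA -[_ *m M *m v]mulmxA -[_ *m (_)^T *m _]mulmxA.
rewrite ebar_mul -[v ^t* *m _]trmxCK adjmx_mul trmxCK eJ ebar_mul.
by rewrite mul_mx_scalar !mxE eqxx !mulr1n mulrC.
Qed.

(** The trace conjugates the voltage rather than the current, hence the conjugate power; this
    explains the sign in [PhiQ]. *)
Lemma mxtrace_Ynode v n phi : network_axioms net -> phi \in P n ->
  \tr (Ynode net n phi *m (v *m v ^t*)) = (injected_power v n phi)^*.
Proof.
by move=> ax phiP; rewrite mxtrace_ebar Ybus_mul // rmorphM /= conjCK.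
Qed.

Lemma mxtrace_PhiV v n phi :
  \tr (PhiV net n phi *m (v *m v ^t*)) = `|entry v n phi| ^+ 2.
Proof. by rewrite -[PhiV _ _ _]mulmx1 mxtrace_ebar mul1mx normCKC. Qed.

Lemma mxtrace_PhiP v n phi : network_axioms net -> phi \in P n ->
  \tr (PhiP net n phi *m (v *m v ^t*)) =
  (complex.Re (injected_power v n phi))%:C%C.
Proof.
move=> ax phiP; rewrite -scalemxAl mxtraceZ mulmxDl mxtraceD mxtrace_adj_outer.
by rewrite mxtrace_Ynode // conjCK ReJ_add mulrC [in RHS]addrC.
Qed.

Lemma mxtrace_PhiQ v n phi : network_axioms net -> phi \in P n ->
  \tr (PhiQ net n phi *m (v *m v ^t*)) =
  (complex.Im (injected_power v n phi))%:C%C.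
Proof.
move=> ax phiP; rewrite -scalemxAl mxtraceZ mulmxBl raddfB /= mxtrace_adj_outer.
by rewrite mxtrace_Ynode // conjCK ImJ_sub [LHS]mulrC ['i%C / _]mulrC mulrA.
Qed.

Lemma phase_entry_subvec v n A phi : phi \in A ->
  phase_entry (subvec v n A) phi = entry v n phi.
Proof.
move=> phiA; rewrite -(enum_rankK_in phiA phiA) phase_entry_in mxE.
rewrite /entry /phase_entry [RHS]big_mkcond; apply: eq_bigr => j _.
by rewrite mxE eq_sym; case: ifP; rewrite ?mul1r ?mul0r.
Qed.

Lemma mxtrace_Phiflow v m n :
  \tr (Phiflow net m n *m (v *m v ^t*)) = (line_power v m n)%:C%C.
Proof.
rewrite -scalemxAl mxtraceZ mulmxDl mxtraceD.
(* The two summands of [Phiflow] are adjoint to each other, so only the real part of the first trace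
   remains. *)
have -> : (Bline net m n) ^t* *m Aline net m n =
          ((Aline net m n) ^t* *m Bline net m n) ^t*.
  by rewrite adjmx_mul trmxCK.
rewrite mxtrace_adj_outer.
suff -> : \tr ((Aline net m n) ^t* *m Bline net m n *m (v *m v ^t*)) =
  \sum_(phi in Pl net m n)
    entry v m phi * (phase_entry (line_current v m n) phi)^*.
  by rewrite /line_power ReJ_add mulrC.
rewrite mxtrace_outer mulmxA -adjmx_mul -mulmxA Aline_mul Bline_mul mxE.
rewrite [RHS]big_enum_val; apply: eq_bigr => i _.
rewrite phase_entry_in -(phase_entry_subvec v m _ _ (enum_valP i)).
by rewrite phase_entry_in !mxE mulrC.
Qed.

End Traces.

(** * Transfer of feasibility, cost and optimality between (P1) and (P3) *)

Section Relaxation.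
Context {R : realType} {N : nat} {net : network R N} {d : opf_data net}.
Context (ax : network_axioms net).
Local Notation C := R[i].
Local Notation P := (nphases net).
Local Notation dim := (\sum_(n < N.+1) #|P n|)%N.
Implicit Types (n : 'I_N.+1) (phi : phase) (v : 'cV[C]_dim).
Implicit Types (x : opf_point net) (k : objective).

Lemma entry_curr_point_of_voltage v n phi : phi \in P n ->
  entry (curr (point_of_voltage d v)) n phi = injected_current v n phi.
Proof.
move=> phiP; rewrite /entry mxcolK -(enum_rankK_in phiP phiP) phase_entry_in.
by rewrite mxE.
Qed.

Lemma submxblock_outer v n :
  submxblock (v *m v ^t*) n n = submxcol v n *m (submxcol v n) ^t*.
Proof.
rewrite submxblockEh -mul_submxrow -submxcol_mul; congr (_ *m _).
by apply/matrixP => i j; rewrite !mxE.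
Qed.

Lemma outer_P3_feasible x : opf_axioms d ->
  P1_feasible d x -> P3_feasible d (volt x *m (volt x) ^t*).
Proof.
move=> axd [xdg xload xcurr xvolt xpg xqg xref].
split=> [n phi nG phiP|n phi nG phiP|s phi sG phiP|s phi sG phiP|n phi phiP||].
- have := xload n phi nG phiP; rewrite xcurr // mxtrace_PhiP //.
  (* The squared modulus becomes an embedded sum of two real squares, so that real and imaginary
     parts can be compared separately. *)
  rewrite /injected_power => ->; rewrite -add_Re2_Im2.
  by apply/eqP; rewrite eq_complex /=; apply/andP; split; apply/eqP; ring.
- have := xload n phi nG phiP; rewrite xcurr // mxtrace_PhiQ // mxtrace_PhiV.
  rewrite /injected_power => ->; rewrite -add_Re2_Im2.
  by apply/eqP; rewrite eq_complex /=; apply/andP; split; apply/eqP; ring.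
- have := xdg s phi sG phiP; rewrite xcurr // mxtrace_PhiP //.
  rewrite /injected_power => ->; rewrite -rmorphD !lecR /=.
  by rewrite !(mul0r, mul1r, subr0, addr0, add0r, sub0r, oppr0) subrK xpg.
- have := xdg s phi sG phiP; rewrite xcurr // mxtrace_PhiQ //.
  rewrite /injected_power => ->; rewrite -rmorphD !lecR /=.
  by rewrite !(mul0r, mul1r, subr0, addr0, add0r, sub0r, oppr0) subrK xqg.
- have /andP[vlo vhi] := xvolt n phi phiP; rewrite mxtrace_PhiV.
  apply/andP; split; apply: lerXn2r => //; rewrite nnegrE ?normr_ge0 // ler0c.
    exact: vmin_ge0.
  exact: vmax_ge0.
- exact: psd_outer.
- by rewrite submxblock_outer xref.
Qed.

Lemma point_of_voltage_feasible v : opf_axioms d ->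
  P3_feasible d (v *m v ^t*) -> submxcol v ord0 = vref d ->
  P1_feasible d (point_of_voltage d v).
Proof.
move=> axd [vpl vql vpg vqg vvolt _ _] vr.
split=> [s phi sG phiP|n phi nG phiP|n phi phiP|n phi phiP|||] //=.
(* Generation was chosen as net injection plus load, so after cancelling the loads the balance is
   the splitting of a complex number. *)
- rewrite entry_curr_point_of_voltage // !addrK -/(injected_power _ _ _).
  exact: complexE.
- rewrite entry_curr_point_of_voltage // -/(injected_power _ _ _).
  have := vpl n phi nG phiP; rewrite mxtrace_PhiP // => /eqP; rewrite addr_eq0.
  have := vql n phi nG phiP; rewrite mxtrace_PhiQ // mxtrace_PhiV => /eqP.
  rewrite subr_eq0 => /eqP/(canRL (addrK _)) Q /eqP Pe.
  by rewrite [LHS]complexE Q Pe; ring.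
- exact: entry_curr_point_of_voltage.
- have := vvolt n phi phiP; rewrite mxtrace_PhiV.
  (* Nonnegative limits allow the squares to be removed from the inequalities. *)
  have [v0 w0] := (vmin_ge0 axd n, vmax_ge0 axd n).
  by rewrite !ler_pXn2r // nnegrE ?normr_ge0 // ler0c.
- move=> s phi sG phiP; have := vpg s phi sG phiP.
  by rewrite mxtrace_PhiP // -rmorphD /= !lecR.
- move=> s phi sG phiP; have := vqg s phi sG phiP.
  by rewrite mxtrace_PhiQ // -rmorphD /= !lecR.
Qed.

(** At generation nodes the traces price generation minus load, whereas (P1) prices generation
    alone. This is the resulting gap, independent of the point. *)
Definition load_cost k : R :=
  if k is SupplyCost
  then \sum_(s in dg d) price d s * \sum_(phi in P s) pload d s phi else 0.

Lemma P3_cost_outer k x : opf_axioms d -> P1_feasible d x ->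
  P3_cost d k (volt x *m (volt x) ^t*) = (P1_cost d k x - load_cost k)%:C%C.
Proof.
move=> axd [xdg _ xcurr _ _ _ _]; case: k => /=.
  rewrite subr0 rmorph_sum; apply: eq_bigr => e _.
  by rewrite !mxtrace_Phiflow rmorphD.
rewrite big_setU1 ?(dg_pcc axd) //= -addrA -sumrB !rmorphD rmorph_sum /=.
congr (_ + _).
  rewrite rmorphM /=; congr (_ * _); rewrite raddf_sum rmorph_sum /=.
  by apply: eq_bigr => phi phiP; rewrite mxtrace_PhiP // xcurr.
apply: eq_bigr => s sG; rewrite -mulrBr rmorphM -sumrB rmorph_sum /=.
congr (_ * _); apply: eq_bigr => phi phiP; rewrite mxtrace_PhiP //.
rewrite /injected_power -xcurr // xdg //=.
by rewrite !(mul0r, mul1r, subr0, addr0, add0r, sub0r, oppr0).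
Qed.

(** Every competitor in (P1) lifts to its outer product in (P3), and the common [load_cost] cancels
    from the comparison. *)
Lemma P1_optimal_of_outer k v : opf_axioms d ->
  P3_optimal d k (v *m v ^t*) -> submxcol v ord0 = vref d ->
  P1_optimal d k (point_of_voltage d v).
Proof.
move=> axd [vF vopt] vr; have xF := point_of_voltage_feasible _ axd vF vr.
split=> // y yF; have := vopt _ (outer_P3_feasible _ axd yF).
by rewrite -[v]/(volt (point_of_voltage d v)) !P3_cost_outer // lecR lerD2r.
Qed.

End Relaxation.

Theorem proposition1 (R : realType) (N : nat) (net : network R N)
    (d : opf_data net) (k : objective)
    (Vopt : 'M[R[i]]_(\sum_(n < N.+1) #|nphases net n|)) :
  network_axioms net -> opf_axioms d ->
  P3_optimal d k Vopt -> \rank Vopt = 1%N ->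
  exists lam : R,
    [/\ 0 < lam,
        forall mu : R[i], mu != 0 -> eigenvalue Vopt mu = (mu == (lam%:C)%C),
        exists u, aligned_eigenvector d Vopt lam u
      & forall u, aligned_eigenvector d Vopt lam u ->
          P1_optimal d k (point_of_voltage d ((Num.sqrt lam)%:C%C *: u))].
Proof.
move=> ax axd Vopt_opt rV; have [[_ _ _ _ _ Vpsd Vref] _] := Vopt_opt.
have [w w0 Vw] := psd_rank1_outer _ Vpsd rV.
have t0 := normsq_gt0 _ w0; set t := \sum_i _ in t0.
(* [t] is a sum of squared moduli, hence real. *)
pose lam := complex.Re t; have tE : t = lam%:C%C by rewrite RRe_real ?gtr0_real.
have lam0 : 0 < lam by rewrite -ltcR -tE.
pose r : R[i] := (Num.sqrt lam)%:C%C.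
have r2 : r ^+ 2 = t by rewrite -rmorphXn /= sqr_sqrtr ?ltW.
have r0 : 0 < r by rewrite ltcR sqrtr_gt0.
exists lam; split=> // [mu mu0||u [Vu u1 ur]].
- by rewrite Vw outer_norm_eigenvalue // -tE.
(* The reference and the [ord0] part of [w] have equal outer products, and the reference is
   nonzero. *)
- have [c c1 cw] : exists2 c : R[i], `|c| = 1 & vref d = c *: submxcol w ord0.
    apply: outer_inj_phase _ _ (vref_neq0 axd) _.
    by rewrite -Vref Vw submxblock_outer.
  (* Dividing by [r], the norm of [w], normalizes; the unit scalar [c] rotates [r *: u] onto the
     reference. *)
  exists ((c / r) *: w); split.
  + rewrite Vw -scalemxAr -mulmxA normsq_col -/t mul_mx_scalar -tE !scalerA.
    by rewrite mulrC.
  + under eq_bigr do rewrite mxE normrM exprMn.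
    rewrite -mulr_sumr normrM normfV c1 mul1r gtr0_norm // exprVn r2.
    by rewrite mulVf ?gt_eqF.
  + rewrite scalerA mulrCA mulfV ?gt_eqF // mulr1 cw.
    by apply/matrixP => i j; rewrite !mxE.
- apply: P1_optimal_of_outer => //.
  (* Any aligned [u] rebuilds [Vopt]: the eigenvalue equation makes it a multiple of [w], and its
     unit norm fixes the modulus of the factor. *)
  suff <- : Vopt = (r *: u) *m (r *: u) ^t* by [].
  have [c uc] : exists c, u = c *: w.
    move: Vu; rewrite Vw -mulmxA [w ^t* *m u]mx11_scalar mul_mx_scalar -tE.
    move=> e; exists (t^-1 * (w ^t* *m u) 0 0).
    by rewrite -scalerA e scalerA mulVf ?scale1r ?gt_eqF.
  rewrite scale_outer uc scale_outer scalerA gtr0_norm // r2 -Vw.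
  suff -> : t * `|c| ^+ 2 = 1 by rewrite scale1r.
  rewrite -[RHS]u1 uc mulrC mulr_sumr; apply: eq_bigr => i _.
  by rewrite mxE normrM exprMn.
Qed.
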